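(* Consider the system described in the context with infinite battery capacity, mean harvested energy per slot $\bar A>0$, and $p_c\in(0,1]$. Define $$C_{\mathrm{thr,PO}}=\min\Big\{N,\Big\lfloor \frac{(N+p_c)\bar A}{p_cE_p}\Big\rfloor\Big\}.$$ Under the push-only threshold-based (POTB) policy, the SBS acts as follows in slot $k$: - if $C_k<C_{\mathrm{thr,PO}}$ and $E_k\ge E_p$, it pushes; - otherwise it sleeps (it never unicasts). Then the blocking probability equals $$p_{\mathrm{blk,PO}}=p_u\Big(1-\sum_{i=1}^{C_{\mathrm{thr,PO}}}f_i\Big).$$
   Context: Time is slotted. There are $N$ contents ranked $c_1,\dots,c_N$, and rank $i$ has popularity $f_i=\frac{i^{-v}}{\sum_{j=1}^N j^{-v}}$ with $v\ge0$. Popularity dynamics: in each slot, with probability $p_c$, a uniformly chosen content is removed; the contents below it move up one rank, and a new content enters at rank $N$. Push state and actions: users store $c_1,\dots,c_{C_k}$ ($C_k\in\{0,\dots,N\}$). In each slot the SBS chooses sleep (cost $0$), unicast (cost $E_u(d)$, where $d$ is the requester's distance) or push (cost $E_p$, sends $c_{C_k+1}$ to all users). The energy used must not exceed the battery level $E_k$. Transitions of $C_k$: - without push: $C_{k+1}=C_k-1$ with probability $p_cC_k/N$, else $C_k$; - with push: $C_{k+1}=C_k$ with probability $p_cC_k/N$, else $C_k+1$. Requests: each slot, independently, with probability $p_u$ there is a request, for $c_i$ with probability $f_i$, at a location uniform in a disk of radius $R$. A request is blocked if its content has rank $>C_k$ and it is neither unicast nor pushed in that slot. The blocking probability is the long-run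 fraction of slots with a blocked request. Energy: the battery evolves as $E_{k+1}=E_k-U_k+A_k$ (infinite capacity), where $U_k$ is the energy used in slot $k$ and the harvested energies $A_k$ are i.i.d. with mean $\bar A$. *)

(* Defs.v *)
From HB Require Import structures.
From mathcomp Require Import all_boot all_order all_algebra.
From mathcomp Require Import all_classical all_reals all_analysis.
Set Implicit Arguments. Unset Strict Implicit. Unset Printing Implicit Defensive.
Import Order.TTheory GRing.Theory Num.Theory.
Local Open Scope ring_scope.

Definition popularity {R : realType} (N : nat) (v : R) (i : nat) : R :=
  (i%:R `^ (- v)) / (\sum_(1 <= j < N.+1) (j%:R `^ (- v))).

(* C_thr,PO = min { N, floor ((N + p_c) Abar / (p_c E_p)) }.
   The argument is nonnegative, so truncn coincides with the floor. *)
Definition Cthr_PO {R : realType} (N : nat) (pc Ep Abar : R) : nat :=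
  minn N (Num.truncn ((N%:R + pc) * Abar / (pc * Ep))).

Definition potb_push {R : realType} (Cthr : nat) (Ep : R) (C : nat) (E : R) : bool :=
  (C < Cthr)%N && (Ep <= E).

(* State (C_k, E_k) under POTB.
   X k w in {0,...,N}: 0 = no popularity change in slot k, j >= 1 = the content
   of rank j is removed.  A removal of a rank <= C_k lowers C by one, which gives
   exactly the transition probabilities p_c C_k / N of the context (with and
   without push).  A k w = harvested energy in slot k. *)
Fixpoint potb_state {R : realType} {T : Type} (Cthr : nat) (Ep : R)
    (C0 : nat) (E0 : R) (A : nat -> T -> R) (X : nat -> T -> nat)
    (k : nat) (w : T) : nat * R :=
  match k with
  | 0 => (C0, E0)
  | k'.+1 =>
      let s := potb_state Cthr Ep C0 E0 A X k' w in
      let C := s.1 in let E := s.2 in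
      let push := potb_push Cthr Ep C E in
      let D := (0 < X k' w)%N && (X k' w <= C)%N in
      ((C + push - D)%N, E - (if push then Ep else 0) + A k' w)
  end.

(* Rq k w in {0,...,N}: 0 = no request in slot k, i >= 1 = request for rank i.
   The request is blocked iff its rank exceeds C_k and it is not served by the
   push of c_{C_k+1} in that slot (POTB never unicasts). *)
Definition potb_blocked {R : realType} {T : Type} (Cthr : nat) (Ep : R)
    (C0 : nat) (E0 : R) (A : nat -> T -> R) (X Rq : nat -> T -> nat)
    (k : nat) (w : T) : bool :=
  let s := potb_state Cthr Ep C0 E0 A X k w in
  let push := potb_push Cthr Ep s.1 s.2 in
  let r := Rq k w in
  [&& (0 < r)%N, (s.1 < r)%N & ~~ (push && (r == s.1.+1))].

(* Main.v *)
(* With G_k = C_k + push_k, a request is blocked exactly when its rank exceeds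
   G_k, so it suffices to show that G_k differs from the threshold m on a set of
   slots of density zero.  Counting removals (a martingale law of large numbers
   gives sum D_k ~ (p_c / N) sum C_k) turns a deficit in the average of G_k into
   a push rate below m p_c / (N + p_c), while E_K < E_p forces the push rate
   up to time K to be close to Abar / E_p, which is at least m p_c / (N + p_c).
   Hence the accumulated deficit is o(K) at every slot K without energy; between
   such slots the cache refills to m - 1 or more in o(K) slots and stays there.
   This also covers the critical case of equality, where the battery level is
   null recurrent.  Only the lower bound liminf (1/K) sum A_k >= Abar is needed,
   so simple functions below the identity reduce it to events. *)
Require Import Defs.
From HB Require Import structures.
From mathcomp Require Import all_boot all_order all_algebra.
From mathcomp Require Import all_classical all_reals all_analysis.
From mathcomp Require Import measurable_realfun ring lra zify.
Set Implicit Arguments.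
Unset Strict Implicit.
Unset Printing Implicit Defensive.
Import Order.TTheory GRing.Theory Num.Theory.
Local Open Scope classical_set_scope.
Local Open Scope ring_scope.

(** * Sublinear sequences *)

(* [limsup x K / K <= 0], phrased without dividing by [K]. *)
Definition subl {R : realType} (x : nat -> R) :=
  forall e : R, 0 < e -> exists B : R, forall K : nat, x K <= e * K%:R + B.

Section Subl.
Variable R : realType.
Implicit Types (x y : nat -> R) (a c : R).

Lemma subl_le x y c : (forall K, x K <= y K + c) -> subl y -> subl x.
Proof.
move=> xy sy e e0; have [B HB] := sy e e0; exists (B + c) => K.
by have := xy K; have := HB K; lra.
Qed.

Lemma sublD x y : subl x -> subl y -> subl (fun K => x K + y K).
Proof.
move=> sx sy e e0; have e2 : 0 < e / 2 by lra.
have [B HB] := sx _ e2; have [B' HB'] := sy _ e2; exists (B + B') => K.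
by have := HB K; have := HB' K; lra.
Qed.

Lemma sublZ c x : 0 <= c -> subl x -> subl (fun K => c * x K).
Proof.
move=> c0 sx e e0; have e2 : 0 < e / (c + 1) by apply: divr_gt0 => //; lra.
have [B HB] := sx _ e2; exists (c * B) => K.
have h1 : c * x K <= c * (e / (c + 1) * K%:R + B) by apply: ler_wpM2l.
have h2 : c * (e / (c + 1)) <= e.
  rewrite mulrA ler_pdivrMr; last by lra.
  by nra.
have K0 : 0 <= K%:R :> R by [].
have h3 : c * (e / (c + 1)) * K%:R <= e * K%:R by apply: ler_wpM2r.
by lra.
Qed.

Lemma subl_bounded x c : (forall K, x K <= c) -> subl x.
Proof.
move=> xc e e0; exists c => K; have := xc K.
have : 0 <= e * K%:R by rewrite mulr_ge0// ltW.
by lra.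
Qed.

Lemma subl_sum (I : Type) (r : seq I) (Q : pred I) (x : I -> nat -> R) :
  (forall i, Q i -> subl (x i)) -> subl (fun K => \sum_(i <- r | Q i) x i K).
Proof.
move=> sx; elim: r => [|i r IH].
  by apply: (@subl_bounded _ 0) => K; rewrite big_nil.
have [Qi|Qi] := boolP (Q i); last first.
  by apply: (@subl_le _ _ 0 _ IH) => K; rewrite big_cons (negbTE Qi) addr0.
apply: (@subl_le _ (fun K => x i K + \sum_(j <- r | Q j) x j K) 0).
  by move=> K; rewrite big_cons Qi addr0.
by apply: sublD => //; exact: sx.
Qed.

Lemma subl_near x (e : R) : subl x -> 0 < e ->
  \forall K \near \oo, x K <= e * K%:R.
Proof.
move=> sx e0; have e2 : 0 < e / 2 by lra.
have [B HB] := sx _ e2.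
near=> K.
have bK : B <= e / 2 * K%:R.
  rewrite -ler_pdivrMl//; near: K; exact: nbhs_infty_ger.
by have := HB K; lra.
Unshelve. all: by end_near. Qed.

Lemma subl_cvg x : subl x -> subl (fun K => - x K) ->
  (fun K : nat => K%:R^-1 * x K) @ \oo --> (0 : R^o).
Proof.
move=> sx sNx; apply/cvgr0Pnorm_le => e e0.
near=> K.
have K0 : (0 < K)%N by near: K; exists 1%N.
have KR : 0 < K%:R :> R by rewrite ltr0n.
rewrite normrM normfV (gtr0_norm KR) ler_pdivrMl// ler_norml lerNl mulrC.
by apply/andP; split; near: K; exact: subl_near.
Unshelve. all: by end_near. Qed.

Lemma subl_scale c x :
  subl x -> subl (fun K => - x K) -> subl (fun K => c * x K).
Proof.
move=> sx sNx; have [c0|/ltW c0] := leP 0 c; first exact: sublZ.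
apply: (@subl_le _ (fun K => - c * - x K) 0) => [K|]; first by rewrite mulrNN addr0.
by apply: sublZ sNx; rewrite oppr_ge0.
Qed.

Lemma subl_mean_cvg (b : nat -> R) (L : R) :
  subl (fun K => \sum_(k < K) (b k - L)) ->
  subl (fun K => - \sum_(k < K) (b k - L)) ->
  (fun K : nat => K%:R^-1 * \sum_(k < K) b k) @ \oo --> (L : R^o).
Proof.
move=> sb sNb; rewrite -[X in _ --> (X : R^o)]add0r.
apply: cvg_trans (cvgD (subl_cvg sb sNb) (cvg_cst (L : R^o))).
apply: near_eq_cvg; near=> K => /=.
have K0 : K%:R != 0 :> R by rewrite pnatr_eq0 -lt0n; near: K; exists 1%N.
change (K%:R^-1 * \sum_(k < K) (b k - L) + L = K%:R^-1 * \sum_(k < K) b k).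
rewrite sumrB sumr_const card_ord mulrBr -[L *+ K]mulr_natl mulKf//.
by rewrite subrK.
Unshelve. all: by end_near. Qed.

End Subl.

(** * Trajectories of the push-only policy *)

(** One outcome of the probability space, made deterministic: [D] is the 0/1 removal indicator and
    [a] the harvest. Probability enters the trajectory lemmas only through [subl] hypotheses. Since
    [D k <= C k], the subtraction in [cachedS] never truncates. *)
Record trajectory {R : realType} (m : nat) (Ep : R)
    (C D : nat -> nat) (push : nat -> bool) (E a : nat -> R) : Prop := {
  pushE : forall k, push k = (C k < m)%N && (Ep <= E k);
  cachedS : forall k, C k.+1 = (C k + push k - D k)%N;
  removed_le : forall k, (D k <= C k)%N;
  removed_le1 : forall k, (D k <= 1)%N;
  energyS : forall k, E k.+1 = E k - (if push k then Ep else 0) + a k }.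

Section Trajectory.
Variables (R : realType) (m : nat) (Ep : R) (C D : nat -> nat)
  (push : nat -> bool) (E a : nat -> R).
Hypothesis tr : trajectory m Ep C D push E a.

(** A push happens only below [m], so no level [n >= m] is ever crossed upwards. Used with [n = m]
    (the threshold is absorbing from above) and [n = N]. *)
Lemma cached_le_stable n k l : (m <= n)%N -> (k <= l)%N ->
  (C k <= n)%N -> (C l <= n)%N.
Proof.
move=> mn kl Ck; elim: l kl => [|l IH]; first by rewrite leqn0 => /eqP <-.
rewrite leq_eqVlt => /predU1P[<-//|/IH {}IH]; rewrite (cachedS tr) (pushE tr).
by case: ltnP => [h|_]/=; [case: (_ <= _)%R => /=|]; lia.
Qed.

Lemma sum_removed K : (forall k, (m <= C k)%N) ->
  (C K + \sum_(k < K) D k = C 0)%N.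
Proof.
move=> mC; elim: K => [|K IH]; first by rewrite big_ord0 addn0.
rewrite big_ord_recr/= (cachedS tr) (pushE tr) ltnNge mC addn0 -IH.
by rewrite addnA addnAC subnK// (removed_le tr).
Qed.

Lemma sum_push K : \sum_(k < K) (push k)%:R =
  (C K)%:R - (C 0)%:R + \sum_(k < K) (D k)%:R :> R.
Proof.
elim: K => [|K IH]; first by rewrite !big_ord0 subrr addr0.
rewrite !big_ord_recr/= IH (cachedS tr) natrB; last first.
  by rewrite (leq_trans (removed_le tr K))// leq_addr.
by rewrite natrD; ring.
Qed.

Lemma energy_balance K :
  E K = E 0 + \sum_(k < K) a k - Ep * \sum_(k < K) (push k)%:R.
Proof.
elim: K => [|K IH]; first by rewrite !big_ord0 mulr0 subr0 addr0.
by rewrite !big_ord_recr/= (energyS tr) IH; case: (push K) => /=; ring.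
Qed.

Lemma cached_push_le k : (C k <= m)%N -> (C k + push k <= m)%N.
Proof. by rewrite (pushE tr); case: ltnP => /=; case: (Ep <= E k) => /=; lia. Qed.

(** With enough energy the push of the slot itself makes up one unit of the deficit; at [C k = m]
    both truncated differences are 0. *)
Lemma powered_deficit k : (C k <= m)%N -> ~~ ((C k < m)%N && (E k < Ep)) ->
  (m - (C k + push k) = m.-1 - C k)%N.
Proof.
rewrite (pushE tr); case: ltnP => /=; last by lia.
by rewrite -leNgt => + _ ->/=; lia.
Qed.

(* While energy lasts, the truncated shortfall [m.-1 - C k] drops by one in each
   slot without removal, and stays at 0 once there. *)
Lemma shortfallS k : (C k <= m)%N -> ~~ ((C k < m)%N && (E k < Ep)) ->
  (m.-1 - C k.+1 + (0 < m.-1 - C k) =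
   m.-1 - C k + (0 < m.-1 - C k)%N * D k)%N.
Proof.
move=> Cm; rewrite (cachedS tr) (pushE tr).
have := removed_le tr k; have := removed_le1 tr k.
case: (ltnP (C k) m) => Ckm/=; last by nia.
by rewrite -leNgt => d1 dc ->/=; nia.
Qed.

Lemma sum_shortfall L K : (L <= K)%N ->
  (forall k, (L <= k < K)%N -> (C k <= m)%N) ->
  (forall k, (L <= k < K)%N -> ~~ ((C k < m)%N && (E k < Ep))) ->
  \sum_(L <= k < K) (0 < m.-1 - C k)%N%:R * (1 - (D k)%:R) =
  (m.-1 - C L)%:R - (m.-1 - C K)%:R :> R.
Proof.
elim: K => [|K IH]; first by rewrite leqn0 => /eqP->; rewrite big_geq// subrr.
rewrite leq_eqVlt => /predU1P[->|LK] Cm on; first by rewrite big_geq// subrr.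
have sub k : (L <= k < K)%N -> (L <= k < K.+1)%N by lia.
rewrite big_nat_recr//= IH//;
  [|by move=> k /sub; exact: Cm|by move=> k /sub; exact: on].
have KK : (L <= K < K.+1)%N by lia.
have := shortfallS (Cm _ KK) (on _ KK).
by move=> /(congr1 (fun n => n%:R : R)); rewrite !natrD natrM; lra.
Qed.

End Trajectory.

(** Above [m] there is no push, so at most [C 0 <= N] removals could ever occur, whereas the removal
    law forces about [q] per slot or more. *)
Lemma cached_eventually_le (R : realType) (N m : nat) (Ep q : R)
    (C D : nat -> nat) (push : nat -> bool) (E a : nat -> R) :
  trajectory m Ep C D push E a -> (C 0 <= N)%N -> 0 < q ->
  subl (fun K => \sum_(k < K) (q * (C k)%:R - (D k)%:R)) ->
  exists k0, (C k0 <= m)%N.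
Proof.
move=> tr C0N q0 HD; apply/not_existsP => Cm.
have Cm' k : (m < C k)%N by rewrite ltnNge; exact/negP/Cm.
have q2 : 0 < q / 2 by lra.
have s1 : subl (fun K => q * K%:R).
  apply: (@subl_le _ _ _ N%:R _ HD) => K.
  have sumD : (\sum_(k < K) D k <= N)%N.
    by rewrite (leq_trans _ C0N)// -(sum_removed tr K) ?leq_addl// => k; exact: ltnW.
  rewrite sumrB -natr_sum.
  have : q * K%:R <= \sum_(k < K) q * (C k)%:R.
    rewrite mulr_natr -[X in q *+ X]card_ord -sumr_const ler_sum// => k _.
    apply: ler_peMr; first exact: ltW.
    by rewrite ler1n; have := Cm' k; lia.
  have : (\sum_(k < K) D k)%:R <= N%:R :> R by rewrite ler_nat.
  by lra.
have [B HB] := s1 _ q2.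
have [n Bn] : exists n, 2 * B / q < n%:R.
  exists (Num.bound `|2 * B / q|).
  by rewrite (le_lt_trans (ler_norm _))// archi_boundP.
move: Bn.
by rewrite ltr_pdivrMr//; have := HB n; lra.
Qed.

(** Pushes and removals differ by at most [N], and removals follow [q * C], so [q] times the deficit
    is at most [q * m * K - (1 + q) * PP] up to a sublinear error, with [PP] the number of pushes.
    An empty battery forces [PP] up to about the harvest divided by [Ep], and the threshold
    inequality closes the gap. *)
Lemma deficit_when_starved (R : realType) (N m : nat) (q Ep Abar : R)
    (C D : nat -> nat) (push : nat -> bool) (E a : nat -> R) :
  trajectory m Ep C D push E a -> (m <= N)%N -> (C 0 <= N)%N ->
  0 < q -> 0 < Ep -> m%:R * q * Ep <= (1 + q) * Abar ->
  subl (fun K => Abar * K%:R - \sum_(k < K) a k) ->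
  subl (fun K => \sum_(k < K) ((D k)%:R - q * (C k)%:R)) ->
  forall e : R, 0 < e -> exists B, forall K, E K < Ep ->
    \sum_(k < K) (m%:R - (C k + push k)%:R) <= e * K%:R + B.
Proof.
move=> tr mN C0N q0 Ep0 mle Ha HD e e0.
have s : subl (fun K => (1 + q) / Ep * (Abar * K%:R - \sum_(k < K) a k) +
    \sum_(k < K) ((D k)%:R - q * (C k)%:R)).
  apply: sublD HD; apply: sublZ => //.
  by rewrite divr_ge0 ?ltW//; lra.
have eq0 : 0 < e * q by rewrite mulr_gt0.
have [B HB] := s _ eq0.
(* [B] is the statistical error, [N] bounds [C K], the last term is the battery offset; the division
   by [q] undoes the scaling of the deficit by [q]. *)
exists ((B + N%:R + (1 + q) / Ep * (Ep - E 0)) / q) => K EK.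
rewrite -(ler_pM2l q0).
have -> : \sum_(k < K) (m%:R - (C k + push k)%:R) =
    m%:R * K%:R - \sum_(k < K) (C k)%:R - \sum_(k < K) (push k)%:R :> R.
  rewrite sumrB sumr_const card_ord mulr_natr -addrA -opprD -big_split/=.
  by congr (_ - _); apply: eq_bigr => k _; exact: natrD.
have {HB} /= := HB K; rewrite sumrB -mulr_sumr.
have := sum_push tr K; have := energy_balance tr K.
set PP := \sum_(k < K) (push k)%:R; set SC := \sum_(k < K) (C k)%:R.
set SD := \sum_(k < K) (D k)%:R; set Sa := \sum_(k < K) a k => EB PE HB.
have CN : (C K)%:R <= N%:R :> R by rewrite ler_nat (cached_le_stable tr mN _ C0N).
have C0' : 0 <= (C 0)%:R :> R by [].
have hB : q * (e * K%:R + (B + N%:R + (1 + q) / Ep * (Ep - E 0)) / q) =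
  e * q * K%:R + B + N%:R + (1 + q) / Ep * (Ep - E 0) by field; lra.
rewrite hB.
have h1 : (1 + q) * PP >= (1 + q) / Ep * (E 0 + Sa - Ep).
  rewrite -mulrA ler_wpM2l//; first by lra.
  by rewrite ler_pdivrMl//; lra.
have h2 : q * m%:R * K%:R <= (1 + q) / Ep * (Abar * K%:R).
  rewrite mulrA ler_wpM2r// mulrAC ler_pdivlMr//; lra.
by lra.
Qed.

(** The shortfall [m.-1 - C k] never exceeds [m] and drops in each powered slot without removal, so
    there are few slots with positive shortfall. The bound is uniform in the starting slot [L]. *)
Lemma deficit_while_powered (R : realType) (N m : nat) (q Ep : R)
    (C D : nat -> nat) (push : nat -> bool) (E a : nat -> R) :
  trajectory m Ep C D push E a -> (m <= N)%N -> 0 < q -> q * N%:R <= 1 ->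
  (forall phi : nat -> R,
    subl (fun K => \sum_(k < K) phi (C k) * ((D k)%:R - q * (C k)%:R))) ->
  forall e : R, 0 < e -> exists B, forall L K, (L <= K)%N ->
    (forall k, (L <= k < K)%N -> (C k <= m)%N) ->
    (forall k, (L <= k < K)%N -> ~~ ((C k < m)%N && (E k < Ep))) ->
    \sum_(L <= k < K) (m%:R - (C k + push k)%:R) <= e * K%:R + B.
Proof.
move=> tr mN q0 qN HD e e0.
pose phi c : R := (0 < m.-1 - c)%N%:R.
have m0 : 0 <= m%:R :> R by [].
have c0 : 0 < m%:R + 1 :> R by lra.
(* Chosen so that [m / q * (2 * e')] is [e * (m / (m + 1))], at most [e]; the [+ 1] covers
   [m = 0]. *)
pose e' := e * q / (2 * (m%:R + 1)).
have e'0 : 0 < e' by rewrite divr_gt0 ?mulr_gt0.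
have [B HB] := HD phi _ e'0.
have [B' HB'] := HD (fun c => - phi c) _ e'0.
exists (m%:R / q * (m%:R + B + B')) => L K LK Cm on.
pose x k := phi (C k) * ((D k)%:R - q * (C k)%:R).
(* A sum over [[L, K)] is a difference of two initial sums: [phi] bounds the one up to [K], [- phi]
   the one up to [L]. *)
have hx : \sum_(L <= k < K) x k <= 2 * e' * K%:R + B + B'.
  have {}HB := HB K; have := HB' L.
  under eq_bigr do rewrite mulNr.
  rewrite sumrN -(big_mkord xpredT x) => hL.
  move: HB; rewrite -(big_mkord xpredT x) (big_cat_nat (n := L))//= => hK.
  have LK' : e' * L%:R <= e' * K%:R by rewrite ler_wpM2l// ?ler_nat// ltW.
  lra.
have hy : \sum_(L <= k < K) phi (C k) * (1 - q * (C k)%:R) <=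
    m%:R + 2 * e' * K%:R + B + B'.
  have -> : \sum_(L <= k < K) phi (C k) * (1 - q * (C k)%:R) =
      \sum_(L <= k < K) phi (C k) * (1 - (D k)%:R) + \sum_(L <= k < K) x k.
    by rewrite -big_split/=; apply: eq_bigr => k _; rewrite /x; ring.
  rewrite /phi (sum_shortfall tr LK Cm on).
  have : (m.-1 - C L)%:R <= m%:R :> R by rewrite ler_nat; lia.
  have : 0 <= (m.-1 - C K)%:R :> R by [].
  by lra.
(* A positive shortfall gives [C k + 1 <= N], hence [1 - q * C k >= q], while the deficit is at most
   [m]. *)
have hz : \sum_(L <= k < K) (m%:R - (C k + push k)%:R) <=
    m%:R / q * \sum_(L <= k < K) phi (C k) * (1 - q * (C k)%:R).
  rewrite mulr_sumr big_nat_cond [leRHS]big_nat_cond.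
  apply: ler_sum => k; rewrite andbT => LkK.
  have -> : m%:R - (C k + push k)%:R = (m.-1 - C k)%:R :> R.
    rewrite -natrB; last by rewrite (cached_push_le tr)// Cm.
    by rewrite (powered_deficit tr) ?Cm// on.
  rewrite /phi; case: (posnP (m.-1 - C k)) => [->|h]; first by rewrite mul0r mulr0.
  rewrite mul1r -mulrA; apply: le_trans (_ : m%:R * 1 <= _).
    by rewrite mulr1 ler_nat (leq_trans (leq_subr _ _))// leq_pred.
  apply: ler_wpM2l => //; rewrite ler_pdivlMl// mulr1.
  have : (C k)%:R + 1 <= N%:R :> R.
    by rewrite natr1 ler_nat (leq_trans _ mN)//; move: h; clear; lia.
  by rewrite -(ler_pM2l q0); lra.
apply: (le_trans hz); apply: le_trans (ler_wpM2l _ hy) _.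
  by rewrite divr_ge0// ltW.
have -> : m%:R / q * (m%:R + 2 * e' * K%:R + B + B') =
  m%:R / q * (2 * e') * K%:R + m%:R / q * (m%:R + B + B') by ring.
rewrite lerD2r ler_wpM2r//.
have -> : m%:R / q * (2 * e') = e * (m%:R / (m%:R + 1)) by rewrite /e'; field; lra.
apply: ler_piMr; first exact: ltW.
by rewrite ler_pdivrMr//; lra.
Qed.

(** Applied to starved slots: before [L] the starved bound applies at [l], after [L] the powered
    bound does. *)
Lemma last_switch (b : pred nat) k0 K : (k0 <= K)%N ->
  exists L, [/\ (k0 <= L <= K)%N, (forall k, (L <= k < K)%N -> ~~ b k) &
    L = k0 \/ exists l, [/\ L = l.+1, (k0 <= l)%N & b l]].
Proof.
elim: K => [|K IH].
  by rewrite leqn0 => /eqP->; exists 0%N; split => //; left.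
rewrite leq_eqVlt => /predU1P[->|kK].
  by exists K.+1; split; [rewrite leqnn|move=> k; lia|left].
have [bK|bK] := boolP (b K).
  by exists K.+1; split; [lia|move=> k; lia|right; exists K; split].
have [L [LK Lb Ls]] := IH kK; exists L; split => //; first by lia.
move=> k kLK; have [->//|kK'] := eqVneq k K; apply: Lb; lia.
Qed.

(** Past [k0] the level [C k + push k] is at most [m], so the indicator of a mismatch is dominated
    by the nonnegative deficit, and the two deficit bounds apply on either side of the last starved
    slot. *)
Lemma cached_eq_threshold (R : realType) (N m : nat) (q Ep Abar : R)
    (C D : nat -> nat) (push : nat -> bool) (E a : nat -> R) :
  trajectory m Ep C D push E a -> (m <= N)%N -> (C 0 <= N)%N ->
  0 < q -> q * N%:R <= 1 -> 0 < Ep -> m%:R * q * Ep <= (1 + q) * Abar ->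
  subl (fun K => Abar * K%:R - \sum_(k < K) a k) ->
  (forall phi : nat -> R,
    subl (fun K => \sum_(k < K) phi (C k) * ((D k)%:R - q * (C k)%:R))) ->
  subl (fun K => \sum_(k < K) (C k + push k != m)%N%:R : R).
Proof.
move=> tr mN C0N q0 qN Ep0 mle Ha HD e e0.
have [k0 Ck0] : exists k0, (C k0 <= m)%N.
  apply: (cached_eventually_le tr C0N q0).
  apply: (@subl_le _ _ _ 0 _ (HD (fun=> -1))) => K.
  by rewrite addr0 ler_sum// => k _; lra.
have Cm k : (k0 <= k)%N -> (C k <= m)%N.
  by move=> k0k; exact: (cached_le_stable tr _ k0k).
have e2 : 0 < e / 2 by lra.
have HD1 : subl (fun K => \sum_(k < K) ((D k)%:R - q * (C k)%:R)).
  apply: (@subl_le _ _ _ 0 _ (HD (fun=> 1))) => K.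
  by rewrite addr0 ler_sum// => k _; lra.
have [B1 HB1] := deficit_when_starved tr mN C0N q0 Ep0 mle Ha HD1 e2.
have [B2 HB2] := deficit_while_powered tr mN q0 qN HD e2.
pose f k : R := m%:R - (C k + push k)%:R.
pose g k : R := (C k + push k != m)%N%:R.
pose F0 := \sum_(0 <= k < k0) f k.
(* [k0] counts the slots before [k0] trivially, [F0] is their deficit, of either sign, which the
   starved bound includes, and [m] pays for the last starved slot itself. *)
pose c := k0%:R + `|B1| + `|B2| + m%:R + `|F0|.
have Gm k : (k0 <= k)%N -> (C k + push k <= m)%N.
  by move=> /Cm; exact: (cached_push_le tr).
have f0 k : (k0 <= k)%N -> 0 <= f k by move=> /Gm; rewrite subr_ge0 ler_nat.
have fm k : f k <= m%:R by rewrite lerBlDr lerDl.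
have gf k : (k0 <= k)%N -> g k <= f k.
  move=> /Gm; rewrite leq_eqVlt /g /f => /predU1P[->|h].
    by rewrite eqxx subrr.
  by rewrite neq_ltn h/= -natrB ?(ltnW h)// ler1n subn_gt0.
have gK K : \sum_(0 <= k < K) g k <= K%:R.
  rewrite -[K%:R]mulr1 mulr_natl -[X in _ *+ X]subn0 -sumr_const_nat.
  by apply: ler_sum => k _; rewrite /g; case: (_ != _).
have nB1 := ler_norm B1; have nB2 := ler_norm B2.
have nB10 := normr_ge0 B1; have nB20 := normr_ge0 B2.
have nF := normr_ge0 F0; have nF' : - F0 <= `|F0| by rewrite -normrN ler_norm.
have m0 : 0 <= m%:R :> R by [].
exists c => K; rewrite -(big_mkord xpredT g).
have eK : 0 <= e * K%:R by rewrite mulr_ge0// ltW.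
have [Kk0|/ltnW k0K] := leqP K k0.
  have : K%:R <= k0%:R :> R by rewrite ler_nat.
  by have := gK K; rewrite /c; lra.
(* [L] follows the last slot without energy before [K]. *)
have [L [/andP[k0L LK] Lb Ls]] :=
  @last_switch (fun k => (C k < m)%N && (E k < Ep)) _ _ k0K.
have HLK : \sum_(L <= k < K) g k <= e / 2 * K%:R + B2.
  apply: le_trans (HB2 L K LK _ Lb); last first.
    by move=> k /andP[Lk _]; apply: Cm; rewrite (leq_trans k0L).
  rewrite big_nat_cond [leRHS]big_nat_cond; apply: ler_sum => k.
  by move=> /andP[/andP[Lk _] _]; apply: gf; rewrite (leq_trans k0L).
rewrite (big_cat_nat (n := L))//=.
suff : \sum_(0 <= k < L) g k <= e / 2 * K%:R + (k0%:R + `|B1| + m%:R + `|F0|).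
  by rewrite /c; lra.
have eK2 : 0 <= e / 2 * K%:R by lra.
case: Ls => [->|[l [Ll k0l /andP[_ El]]]]; first by have := gK k0; lra.
rewrite (big_cat_nat (n := k0))//=.
have : \sum_(k0 <= k < L) g k <= \sum_(k0 <= k < L) f k.
  rewrite big_nat_cond [leRHS]big_nat_cond; apply: ler_sum => k.
  by move=> /andP[/andP[Lk _] _]; exact: gf.
have := HB1 _ El; rewrite -(big_mkord xpredT f) (big_cat_nat (n := k0))//= -/F0.
rewrite Ll [X in _ -> _ <= X -> _]big_nat_recr//= => h1 h2.
have h3 := gK k0; have h4 := fm l.
have h5 : e / 2 * l%:R <= e / 2 * K%:R.
  by rewrite ler_wpM2l ?(ltW e2)// ler_nat; move: LK Ll; clear; lia.
lra.
Qed.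

(** * A strong law of large numbers *)

Lemma sqrt_nat K : exists n, (n ^ 2 <= K < n.+1 ^ 2)%N.
Proof.
elim: K => [|K [n /andP[nK Kn]]]; first by exists 0%N.
have [h|h] := leqP (n.+1 ^ 2) K.+1; last by exists n; rewrite (leq_trans nK).
exists n.+1; rewrite h (leq_ltn_trans Kn)// ltn_sqr//.
Qed.

(** Between [n ^ 2] and [n.+1 ^ 2] a partial sum moves by at most [2 * n], which is negligible
    against [n ^ 2]. *)
Lemma subl_squares (R : realType) (y : nat -> R) :
  (forall k, `|y k| <= 1) ->
  (forall e : R, 0 < e -> \forall n \near \oo,
    `|\sum_(k < n ^ 2) y k| <= e * (n ^ 2)%:R) ->
  subl (fun K => \sum_(k < K) y k).
Proof.
move=> y1 sq e e0; have e2 : 0 < e / 2 by lra.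
have [n0 _ Hn0] := sq _ e2.
have bnd a b : (a <= b)%N -> \sum_(a <= k < b) y k <= (b - a)%:R.
  move=> ab; rewrite -[(b - a)%:R]mulr1 mulr_natl -sumr_const_nat.
  by apply: ler_sum => k _; rewrite (le_trans (ler_norm _)).
exists ((n0 ^ 2)%:R + 2 / e) => K.
have ei : 0 < 2 / e by rewrite divr_gt0.
have eK : 0 <= e * K%:R by rewrite mulr_ge0// ltW.
have nn0 : 0 <= (n0 ^ 2)%:R :> R by [].
have [Kn0|n0K] := leqP K (n0 ^ 2).
  have := bnd 0%N K (leq0n _); rewrite big_mkord subn0.
  have : K%:R <= (n0 ^ 2)%:R :> R by rewrite ler_nat.
  by lra.
have [n /andP[nK Kn]] := sqrt_nat K.
have n0n : (n0 <= n)%N.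
  by rewrite -ltnS -ltn_sqr (leq_trans n0K)// ltnW.
rewrite -(big_mkord xpredT y) (big_cat_nat (n := (n ^ 2)%N))//= big_mkord.
have h1 := Hn0 _ n0n; have h2 := bnd _ _ nK.
have h3 : (K - n ^ 2)%:R <= 2 * n%:R :> R.
  rewrite -natrM ler_nat leq_subLR; move: Kn; rewrite -[n.+1]addn1 sqrnD; clear; lia.
(* Arithmetic-geometric mean inequality: [e] times the difference is half the square of
   [e * n - 2]. *)
have h4 : 2 * n%:R <= e / 2 * (n ^ 2)%:R + 2 / e.
  rewrite -(ler_pM2l e0) -subr_ge0.
  have -> : e * (e / 2 * (n ^ 2)%:R + 2 / e) - e * (2 * n%:R) =
    2^-1 * (e * n%:R - 2) ^+ 2 by rewrite natrX; field; lra.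
  by rewrite mulr_ge0 ?sqr_ge0// invr_ge0.
have h5 : e * (n ^ 2)%:R <= e * K%:R by rewrite ler_wpM2l ?(ltW e0)// ler_nat.
have h6 := ler_norm (\sum_(i < n ^ 2) y i).
rewrite /= in h1; lra.
Qed.

Section StrongLaw.
Import numFieldNormedType.Exports.
Context d (T : measurableType d) (R : realType) (P : probability T R).
Implicit Types f g : T -> R.

Lemma bounded_integrable f (c : R) : measurable_fun setT f ->
  (forall w, `|f w| <= c) -> P.-integrable setT (EFin \o f).
Proof.
move=> mf fc; apply: measurable_bounded_integrable => //.
  by rewrite -ge0_fin_numE// fin_num_measure.
exists c; split; [exact: num_real|move=> x cx w _ /=; exact: (le_trans (fc w) (ltW cx))].
Qed.

Variables (y : nat -> T -> R).
Hypotheses (my : forall k, measurable_fun setT (y k)) (y1 : forall k w, `|y k w| <= 1).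
Hypothesis orth : forall i j, (i < j)%N -> \int[P]_w (y i w * y j w) = 0.

Let S n w := \sum_(k < n) y k w.

Let mS n : measurable_fun setT (S n).
Proof. exact: measurable_sum. Qed.

Let Sn n w : `|S n w| <= n%:R.
Proof.
rewrite (le_trans (ler_norm_sum _ _ _))//.
by rewrite -[n%:R]mulr1 mulr_natl -[X in _ *+ X]card_ord -sumr_const ler_sum.
Qed.

Let int_mul f g (a b : R) : measurable_fun setT f -> measurable_fun setT g ->
  (forall w, `|f w| <= a) -> (forall w, `|g w| <= b) ->
  P.-integrable setT (EFin \o (fun w => f w * g w)).
Proof.
move=> mf mg fa gb; apply: (@bounded_integrable _ (a * b)).
  exact: measurable_funM.
by move=> w; rewrite normrM ler_pM.
Qed.

Let iSS m n : P.-integrable setT (EFin \o (fun w => S m w * S n w)).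
Proof. exact: int_mul (mS m) (mS n) (Sn m) (Sn n). Qed.

Let iSy m n : P.-integrable setT (EFin \o (fun w => S m w * y n w)).
Proof. exact: int_mul (mS m) (my n) (Sn m) (y1 n). Qed.

Let iyy m n : P.-integrable setT (EFin \o (fun w => y m w * y n w)).
Proof. exact: int_mul (my m) (my n) (y1 m) (y1 n). Qed.

Let orthS n : forall m, (m <= n)%N -> \int[P]_w (S m w * y n w) = 0.
Proof.
elim=> [|m IH] mn.
  by under eq_Rintegral do rewrite /S big_ord0 mul0r; rewrite Rintegral_cst// mul0r.
have -> : \int[P]_w (S m.+1 w * y n w) =
    \int[P]_w (S m w * y n w + y m w * y n w).
  by apply: eq_Rintegral => w _; rewrite /S big_ord_recr/= mulrDl.
by rewrite (RintegralD measurableT (iSy m n) (iyy m n)) (IH (ltnW mn)) (orth mn) addr0.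
Qed.

(** Orthogonality kills the cross terms of the expanded square, and each remaining term
    [y n w * y n w] is at most 1. *)
Lemma second_moment n : \int[P]_w (S n w * S n w) <= n%:R.
Proof.
elim: n => [|n IH].
  by under eq_Rintegral do rewrite /S big_ord0 mul0r; rewrite Rintegral_cst// mul0r.
have -> : \int[P]_w (S n.+1 w * S n.+1 w) =
    \int[P]_w (S n w * S n w + (S n w * y n w + (S n w * y n w + y n w * y n w))).
  by apply: eq_Rintegral => w _; rewrite /S big_ord_recr/=; ring.
have i4 := integrableD measurableT (iSy n n) (iyy n n).
have i5 := integrableD measurableT (iSy n n) i4.
rewrite (RintegralD measurableT (iSS n n) i5).
rewrite (RintegralD measurableT (iSy n n) i4).
rewrite (RintegralD measurableT (iSy n n) (iyy n n)) orthS// !add0r.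
rewrite -natr1 lerD//.
have -> : (1 : R) = \int[P]_w 1.
  by rewrite Rintegral_cst// mul1r (congr1 fine (probability_setT P)).
apply: le_Rintegral => //.
  exact: finite_measure_integrable_cst.
by move=> w _; rewrite (le_trans (ler_norm _))// normrM mulr_ile1.
Qed.

(* Along squares [(S_n / n)^2] has summable integrals, hence tends to 0 almost
   everywhere; boundedness of [y] fills the gaps between squares. *)
Lemma slln : {ae P, forall w, subl (fun K => \sum_(k < K) y k w)}.
Proof.
pose z n w : R := (S (n.+1 ^ 2) w / (n.+1 ^ 2)%:R) ^+ 2.
have z0 n w : 0 <= z n w by exact: sqr_ge0.
have mz n : measurable_fun setT (z n).
  by apply: measurable_funX; apply: measurable_funM.
(* The second moment gives the bound [1 / n.+1 ^ 2]; the right-hand side is a telescoping majorant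
   of it, with total sum at most 2. *)
have iz n : (\int[P]_w (z n w)%:E <= (2 / n.+1%:R - 2 / n.+2%:R)%:E)%E.
  pose s : R := (n.+1 ^ 2)%:R.
  have s0 : 0 < s by rewrite ltr0n expn_gt0.
  have sz w : z n w = s ^- 2 * (S (n.+1 ^ 2) w * S (n.+1 ^ 2) w).
    by rewrite /z expr_div_n -expr2 mulrC.
  have zi : P.-integrable setT (EFin \o z n).
    apply: (@bounded_integrable _ 1) => // w.
    rewrite normrX exprn_ile1 ?normr_ge0// normrM normfV (gtr0_norm s0).
    by rewrite ler_pdivrMr// mul1r.
  suff h : \int[P]_w z n w <= 2 / n.+1%:R - 2 / n.+2%:R.
    have fi : (\int[P]_w (z n w)%:E)%E \is a fin_num by exact: integrable_fin_num zi.
    by rewrite -(fineK fi) lee_fin.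
  have -> : \int[P]_w z n w = \int[P]_w (s ^- 2 * (S (n.+1 ^ 2) w * S (n.+1 ^ 2) w)).
    by apply: eq_Rintegral => w _.
  rewrite (RintegralZl _ measurableT (iSS _ _)) (le_trans (ler_wpM2l _ (second_moment _)))//.
    by rewrite invr_ge0 exprn_ge0// ltW.
  rewrite -/s expr2 invfM -mulrA mulVf ?gt_eqF// mulr1 /s natrX.
  rewrite -[n.+2%:R]natr1.
  have n0 : 1 <= n.+1%:R :> R by rewrite ler1n.
  rewrite -subr_ge0.
  have -> : 2 / n.+1%:R - 2 / (n.+1%:R + 1) - (n.+1%:R ^+ 2)^-1 =
    (n.+1%:R - 1) / (n.+1%:R ^+ 2 * (n.+1%:R + 1)) :> R by field; lra.
  by rewrite divr_ge0 ?subr_ge0// mulr_ge0 ?exprn_ge0//; lra.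
pose Z w := (\sum_(n <oo) (z n w)%:E)%E.
have Z_fin : {ae P, forall w, Z w \is a fin_num}.
  have ZP : P.-integrable setT Z.
    apply/integrableP; split.
      apply: ge0_emeasurable_sum => // n; first by move=> w _ _; rewrite lee_fin.
      by move=> _; exact/measurable_EFinP.
    under eq_integral.
      move=> w _; rewrite gee0_abs; last by apply: nneseries_ge0 => n _ _; rewrite lee_fin.
      over.
    rewrite integral_nneseries//=; last 2 first.
      by move=> n; exact/measurable_EFinP.
      by move=> n w _; rewrite lee_fin.
    apply: (@le_lt_trans _ _ 2%:E); last exact: ltry.
    apply: lime_le.
      by apply: is_cvg_nneseries => n _ _; apply: integral_ge0 => w _; rewrite lee_fin.
    apply: nearW => n.
    apply: (@le_trans _ _ (\sum_(0 <= i < n) (2 / i.+1%:R - 2 / i.+2%:R)%:E)%E).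
      by apply: lee_sum => i _.
    rewrite sumEFin lee_fin.
    rewrite (@telescope_sumr_eq _ _ _ (fun i => - (2 / i.+1%:R)))//.
      by rewrite divr1 opprK addrC lerBlDr lerDl divr_ge0.
    by move=> i _; rewrite opprK addrC.
  have := integrable_ae measurableT ZP.
  by apply: filterS => w /(_ I).
apply: filterS Z_fin => w Zw.
apply: (@subl_squares _ (y ^~ w)) => [k|e e0]; first exact: y1.
have zc : cvgn (series (z ^~ w)).
  apply: nondecreasing_is_cvgn.
    by apply: nondecreasing_series => n _ _; exact: z0.
  exists (fine (Z w)) => _ [n _ <-].
  rewrite -lee_fin fineK// /series/= -sumEFin.
  by apply: nneseries_lim_ge => k _ _; rewrite lee_fin.
have /cvgrPdist_le/(_ (e ^+ 2)) := cvg_series_cvg_0 zc.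
move=> /(_ (exprn_gt0 _ e0)) [n0 _ Hn0].
exists n0.+1 => // -[//|n] /= n0n.
have := Hn0 _ n0n; rewrite /= sub0r normrN ger0_norm// /z.
have c0 : 0 < (n.+1 ^ 2)%:R :> R by rewrite ltr0n expn_gt0.
rewrite -real_normK ?num_real// ler_sqr ?nnegrE ?normr_ge0 ?(ltW e0)//.
by rewrite normrM normfV (gtr0_norm c0) ler_pdivrMr.
Qed.

End StrongLaw.

(** * Strong law along predictable sets of slots, and tools for independence *)

Section PredictableLaw.
Context d (T : measurableType d) (R : realType) (P : probability T R).

Lemma Rintegral_indic (Y : set T) : measurable Y ->
  \int[P]_w (\1_Y w : R) = fine (P Y).
Proof. by move=> mY; rewrite /Rintegral integral_indic// setIT. Qed.

Lemma RintegralB_indic (Y Y' : set T) (q : R) : measurable Y -> measurable Y' ->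
  \int[P]_w ((\1_Y w : R) - q * \1_Y' w) = fine (P Y) - q * fine (P Y').
Proof.
move=> mY mY'.
have iY := integrable_indic P mY; have iY' := integrable_indic P mY'.
have iq : P.-integrable setT (EFin \o (fun w => q * \1_Y' w)).
  exact: (integrableZl measurableT q iY').
rewrite (RintegralB measurableT iY iq) (RintegralZl _ measurableT iY').
by rewrite !Rintegral_indic.
Qed.

(** [S k] is meant to be decided before slot [k] and [Z k] to be a fresh event of probability [q].
    The variables [\1_(S k) * (\1_(Z k) - q)] are martingale differences; the two product hypotheses
    are what their orthogonality requires. *)
Lemma slln_predictable (S Z : nat -> set T) (q : R) :
  (forall k, measurable (S k)) -> (forall k, measurable (Z k)) ->
  (forall k, P (Z k) = q%:E) ->
  (forall i j, (i < j)%N ->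
    P (S i `&` Z i `&` S j `&` Z j) = (P (S i `&` Z i `&` S j) * q%:E)%E) ->
  (forall i j, (i < j)%N -> P (S i `&` S j `&` Z j) = (P (S i `&` S j) * q%:E)%E) ->
  {ae P, forall w, subl (fun K => \sum_(k < K) \1_(S k) w * (\1_(Z k) w - q)) /\
    subl (fun K => \sum_(k < K) \1_(S k) w * (q - \1_(Z k) w))}.
Proof.
move=> mS mZ PZ h1 h2.
have q0 : 0 <= q by rewrite -lee_fin -(PZ 0%N).
have q1 : q <= 1 by rewrite -lee_fin -(PZ 0%N) probability_le1.
pose y k w : R := \1_(S k) w * (\1_(Z k) w - q).
have my k : measurable_fun setT (y k).
  by apply: measurable_funM => //; apply: measurable_funB.
have y1 k w : `|y k w| <= 1.
  rewrite /y !indicE; case: (w \in S k); case: (w \in Z k) => /=;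
    rewrite ?mul1r ?mul0r ?normr0// ler_norml; apply/andP; split; lra.
have orth i j : (i < j)%N -> \int[P]_w (y i w * y j w) = 0.
  move=> ij.
  pose Y1 := S i `&` Z i `&` S j `&` Z j; pose Y2 := S i `&` Z i `&` S j.
  pose Y3 := S i `&` S j `&` Z j; pose Y4 := S i `&` S j.
  have mY1 : measurable Y1 by do !apply: measurableI.
  have mY2 : measurable Y2 by do !apply: measurableI.
  have mY3 : measurable Y3 by do !apply: measurableI.
  have mY4 : measurable Y4 by do !apply: measurableI.
  pose u w : R := \1_Y1 w - q * \1_Y2 w; pose v w : R := \1_Y3 w - q * \1_Y4 w.
  have bnd (Y Y' : set T) w : `|(\1_Y w : R) - q * \1_Y' w| <= 2.
    rewrite !indicE; case: (w \in Y); case: (w \in Y') => /=;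
      rewrite ?mulr1 ?mulr0 ler_norml; apply/andP; split; lra.
  have iu : P.-integrable setT (EFin \o u).
    apply: (@bounded_integrable _ _ _ _ _ 2) => [|w]; last exact: bnd.
    by apply: measurable_funB => //; apply: measurable_funM.
  have iv : P.-integrable setT (EFin \o v).
    apply: (@bounded_integrable _ _ _ _ _ 2) => [|w]; last exact: bnd.
    by apply: measurable_funB => //; apply: measurable_funM.
  have iqv : P.-integrable setT (EFin \o (fun w => q * v w)).
    exact: (integrableZl measurableT q iv).
  (* Expanding the factor of slot [i] leaves [u] and [v], each of which integrates to 0 by one
     product hypothesis. *)
  have -> : \int[P]_w (y i w * y j w) = \int[P]_w (u w - q * v w).
    apply: eq_Rintegral => w _; rewrite /y /u /v /Y1 /Y2 /Y3 /Y4 !indicI.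
    by rewrite /=; ring.
  rewrite (RintegralB measurableT iu iqv) (RintegralZl _ measurableT iv).
  rewrite !RintegralB_indic// /Y1 /Y3 h1// h2// !fineM ?fin_num_measure//=.
  by rewrite ![_ * q]mulrC !subrr mulr0 subr0.
have Ny k w : - y k w = \1_(S k) w * (q - \1_(Z k) w) by rewrite /y -mulrN opprB.
have s1 := @slln _ _ _ P y my y1 orth.
have s2 : {ae P, forall w, subl (fun K => \sum_(k < K) - y k w)}.
  apply: (@slln _ _ _ P (fun k w => - y k w)) => [k|k w|i j ij].
  - by apply: measurableT_comp => //; exact: my.
  - by rewrite normrN.
  - by under eq_Rintegral do rewrite mulrNN; exact: orth.
move: s1 s2; apply: filterS2 => w s1 s2; split; first exact: s1.
by apply: (@subl_le _ _ _ 0 _ s2) => K; rewrite addr0 ler_sum// => k _; rewrite Ny.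
Qed.

Lemma total_probability (Y : T -> nat) (Q : set T) :
  (forall j, measurable [set w | Y w = j]) -> measurable Q ->
  P Q = (\sum_(j <oo) P (Q `&` [set w | Y w = j]))%E.
Proof.
move=> mY mQ.
have mQY j : measurable (Q `&` [set w | Y w = j]) by exact: measurableI.
rewrite -measure_semi_bigcup//; last exact: bigcupT_measurable.
- by congr (P _); apply/seteqP; split => [w Qw|w [j _ []]//]; exists (Y w).
- apply/trivIsetP => i j _ _ ij; apply/seteqP; split => // w [[_ Yi] [_ Yj]].
  by move: ij; rewrite -Yi -Yj eqxx.
Qed.

(** Removes a discrete variable from an independence statement by summing over its values. *)
Lemma indep_marginal (Y : T -> nat) (Q Z : set T) :
  (forall j, measurable [set w | Y w = j]) -> measurable Q -> measurable Z ->
  (forall j, P (Q `&` (Z `&` [set w | Y w = j])) =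
     (P Q * P (Z `&` [set w | Y w = j]))%E) ->
  P (Q `&` Z) = (P Q * P Z)%E.
Proof.
move=> mY mQ mZ h.
rewrite (total_probability mY) ?(total_probability mY mZ)//; last exact: measurableI.
have PQ : P Q \is a fin_num by exact: fin_num_measure.
rewrite -(fineK PQ) -nneseriesZl//; apply: eq_eseriesr => j _.
by rewrite fineK// -setIA.
Qed.

(** Pi-lambda argument: the measurable events independent of [Z] form a Dynkin system. *)
Lemma indep_sigma_algebra (G : set (set T)) (Z : set T) :
  setI_closed G -> measurable Z -> (forall S, G S -> measurable S) ->
  (forall S, G S -> P (S `&` Z) = (P S * P Z)%E) ->
  forall S, <<s G>> S -> measurable S /\ P (S `&` Z) = (P S * P Z)%E.
Proof.
move=> GI mZ mG iG.
pose H := [set S | measurable S /\ P (S `&` Z) = (P S * P Z)%E].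
suff : <<s G>> `<=` H by move=> h S /h.
have PZ : P Z \is a fin_num by exact: fin_num_measure.
apply: (@lambda_system_subset _ G GI setT H) => //; last first.
  by move=> S GS; split; [exact: mG|exact: iG].
apply/dynkin_lambda_system; split.
- by split => //; rewrite setTI probability_setT mul1e.
- move=> S [mS hS]; split; first exact: measurableC.
  have PS : P S \is a fin_num by exact: fin_num_measure.
  have e1 : P (Z `\` S) = (P Z - P (Z `&` S))%E.
    by apply: measureD => //; rewrite -ge0_fin_numE.
  rewrite probability_setC// setIC -setDE e1 (setIC Z S) hS.
  by rewrite -(fineK PS) -(fineK PZ) -EFinM -!EFinB -EFinM mulrBl mul1r.
- move=> F tF HF; split; first by apply: bigcupT_measurable => n; exact: (HF n).1.
  have mF n : measurable (F n) by exact: (HF n).1.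
  have mFZ n : measurable (F n `&` Z) by exact: measurableI.
  have tFZ : trivIset setT (fun n => F n `&` Z).
    by apply/trivIsetP => i j _ _ ij; rewrite setIACA (trivIsetP.1 tF)// set0I.
  rewrite setI_bigcupl !measure_semi_bigcup//;
    [|exact: bigcupT_measurable|exact: bigcupT_measurable].
  rewrite muleC -(fineK PZ) -nneseriesZl//; apply: eq_eseriesr => n _.
  by rewrite fineK// muleC; exact: (HF n).2.
Qed.

End PredictableLaw.

(** * Independence from the past *)

(** Case analysis on a countably valued [h]: the event splits into countably many pieces, one per
    value. *)
Lemma measurable_countable_comp d (T : measurableType d) (U : countType)
    (h : T -> U) (Q : U -> set T) :
  (forall u, measurable (h @^-1` [set u])) -> (forall u, measurable (Q u)) ->
  measurable [set w | Q (h w) w].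
Proof.
move=> mh mQ.
rewrite (_ : [set w | Q (h w) w] = \bigcup_u (h @^-1` [set u] `&` Q u)).
  by apply: countable_bigcupT_measurable => // u; exact: measurableI.
by apply/seteqP; split => [w Qw|w [u _ [/= <-]]//]; exists (h w).
Qed.

Lemma measurable_pair_fiber d (T : measurableType d) (U V : countType)
    (f : T -> U) (g : T -> V) :
  (forall u, measurable (f @^-1` [set u])) ->
  (forall v, measurable (g @^-1` [set v])) ->
  forall p, measurable ((fun w => (f w, g w)) @^-1` [set p]).
Proof.
move=> mf mg [u v]; rewrite (_ : _ @^-1` _ = f @^-1` [set u] `&` g @^-1` [set v]).
  exact: measurableI.
by apply/seteqP; split => [w [/= <- <-]|w [/= <- <-]].
Qed.

Section Cylinders.
Context d (T : measurableType d) (R : realType) (P : probability T R).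
Variables (A : nat -> T -> R) (X Rq : nat -> T -> nat).

Definition cylinder n (B : nat -> set R) (J I : nat -> nat) : set T :=
  \big[setI/setT]_(k < n)
    (A k @^-1` B k `&` [set w | X k w = J k] `&` [set w | Rq k w = I k]).

(** Generators of the past before slot [n]. The ranks are pinned to single values, the form in which
    independence is assumed. *)
Definition cylinders n : set (set T) := [set S | exists B J I,
  (forall k, measurable (B k)) /\ S = cylinder n B J I].

Hypotheses (mA : forall k, measurable_fun setT (A k))
  (mX : forall k j, measurable [set w | X k w = j])
  (mRq : forall k i, measurable [set w | Rq k w = i]).
Hypothesis indep : forall n (B : nat -> set R) (J I : nat -> nat),
  (forall k, measurable (B k)) ->
  P (cylinder n B J I) = (\prod_(k < n) (P (A k @^-1` B k) *
     P [set w | X k w = J k] * P [set w | Rq k w = I k]))%E.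

Lemma cylinderP n B J I w : cylinder n B J I w <->
  forall k, (k < n)%N -> [/\ B k (A k w), X k w = J k & Rq k w = I k].
Proof.
rewrite /cylinder -(bigcap_mkord n (fun k => A k @^-1` B k `&`
  [set w | X k w = J k] `&` [set w | Rq k w = I k])); split => h k kn.
  by have [[]] := h k kn.
by have [] := h k kn.
Qed.

Lemma measurable_preimage k (B : set R) : measurable B -> measurable (A k @^-1` B).
Proof. by move=> mB; rewrite -[X in measurable X]setTI; exact: mA. Qed.

Lemma measurable_cylinders n S : cylinders n S -> measurable S.
Proof.
move=> [B [J [I [mB ->]]]]; apply: bigsetI_measurable => k _.
by apply: measurableI => //; apply: measurableI => //; exact: measurable_preimage.
Qed.

Lemma cylinders_setI n : setI_closed (cylinders n).
Proof.
move=> _ _ [B [J [I [mB ->]]]] [B' [J' [I' [mB' ->]]]].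
(* Conflicting ranks make the intersection empty; an empty energy constraint in that slot encodes
   this while keeping the shape of a cylinder. *)
exists (fun k => if (J k == J' k) && (I k == I' k) then B k `&` B' k else set0).
exists J, I; split.
  by move=> k; case: ifP => // _; exact: measurableI.
apply/seteqP; split => [w [/cylinderP h /cylinderP h']|w /cylinderP h].
  apply/cylinderP => k kn; have [? XJ RI] := h _ kn; have [? XJ' RI'] := h' _ kn.
  by rewrite -XJ -RI -XJ' -RI' !eqxx.
by split; apply/cylinderP => k /h[]; case: ifP => // /andP[/eqP e1 /eqP e2] [? ?] *;
  split; congruence.
Qed.

(** The discrete part of the past; its fibres partition the space into countably many cylinders. *)
Definition ranks n w := mkseq (fun k => (X k w, Rq k w)) n.

Lemma ranks_fiber n u w : ranks n w = u <-> size u = n /\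
  forall k, (k < n)%N -> X k w = (nth (0, 0) u k).1 /\ Rq k w = (nth (0, 0) u k).2.
Proof.
split=> [<-|[su h]].
  by rewrite size_mkseq; split => // k kn; rewrite nth_mkseq.
apply: (@eq_from_nth _ (0, 0)%N) => [|k]; rewrite size_mkseq// => kn.
by rewrite nth_mkseq// [RHS]surjective_pairing; have [-> ->] := h _ kn.
Qed.

Lemma ranks_cylinder n u (B : nat -> set R) :
  [set w | ranks n w = u] `&` [set w | forall k, (k < n)%N -> B k (A k w)] =
  if size u == n then
    cylinder n B (fun k => (nth (0, 0) u k).1) (fun k => (nth (0, 0) u k).2)
  else set0.
Proof.
case: eqP => [su|su]; last first.
  by apply/seteqP; split => // w [/ranks_fiber[]].
apply/seteqP; split => [w [/ranks_fiber[_ h] hB]|w /cylinderP h].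
  by apply/cylinderP => k kn; have [] := h _ kn; split => //; exact: hB.
by split; [apply/ranks_fiber; split => // k /h[]|move=> k /h[]].
Qed.

Lemma fiber_cylinder n u : [set w | ranks n w = u] =
  if size u == n then
    cylinder n (fun=> setT) (fun k => (nth (0, 0) u k).1) (fun k => (nth (0, 0) u k).2)
  else set0.
Proof.
by rewrite -ranks_cylinder; apply/seteqP; split => [w|w []].
Qed.

(** [total_probability] sums over a [nat]-valued variable, so the rank history is encoded by
    [pickle]. *)
Lemma pickle_ranks n k :
  (exists u, [set w | pickle (ranks n w) = k] = [set w | ranks n w = u]) \/
  [set w | pickle (ranks n w) = k] = set0.
Proof.
have [[w0 <-]|/forallNP h] := pselect (exists w, pickle (ranks n w) = k).
  left; exists (ranks n w0); apply/seteqP; split => w /=; last by move=> ->.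
  exact: (pcan_inj pickleK).
by right; apply/seteqP; split => // w /h.
Qed.

Lemma measurable_ranks n u : measurable [set w | ranks n w = u].
Proof.
rewrite fiber_cylinder; case: eqP => // _.
by apply: (@measurable_cylinders n); do 3 eexists; split; last by [].
Qed.

(** A cylinder extended by one slot is again a cylinder, so the product formula gives independence
    on generators; the pi-lambda argument extends it to the whole past. *)
Lemma indep_slot n S B j i : <<s cylinders n>> S -> measurable B ->
  P (S `&` (A n @^-1` B `&` [set w | X n w = j] `&` [set w | Rq n w = i])) =
  (P S * P (A n @^-1` B `&` [set w | X n w = j] `&` [set w | Rq n w = i]))%E.
Proof.
move=> FS mB; set Z := _ `&` [set w | Rq n w = i].
have mZ : measurable Z.
  by apply: measurableI => //; apply: measurableI => //; exact: measurable_preimage.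
have cylS B' J' I' : (forall k, measurable (B' k)) ->
    P (cylinder n B' J' I' `&` Z) = (P (cylinder n B' J' I') *
      (P (A n @^-1` B) * P [set w | X n w = j] * P [set w | Rq n w = i]))%E.
  move=> mB'.
  pose ext U (f : nat -> U) (u : U) k := if (k < n)%N then f k else u.
  have extE U (f : nat -> U) u (k : 'I_n) : ext U f u k = f k by rewrite /ext ltn_ord.
  have extn U (f : nat -> U) u : ext U f u n = u by rewrite /ext ltnn.
  have -> : cylinder n B' J' I' `&` Z =
      cylinder n.+1 (ext _ B' B) (ext _ J' j) (ext _ I' i).
    rewrite /cylinder big_ord_recr/= !extn; congr (_ `&` _).
    by apply: eq_bigr => k _; rewrite !extE.
  rewrite !indep//; last by move=> k; rewrite /ext; case: ifP.
  rewrite big_ord_recr/= !extn; congr (_ * _)%E.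
  by apply: eq_bigr => k _; rewrite !extE.
(* [setT] is not a cylinder when [n > 0], so sum over the values of the ranks. *)
have PZ : P Z = (P (A n @^-1` B) * P [set w | X n w = j] * P [set w | Rq n w = i])%E.
  set p := (_ * _ * _)%E.
  have p_fin : p \is a fin_num by rewrite !fin_numM// fin_num_measure//; exact: measurable_preimage.
  have mY k : measurable [set w | pickle (ranks n w) = k].
    by have [[u ->]|->//] := pickle_ranks n k; exact: measurable_ranks.
  have e k : P (Z `&` [set w | pickle (ranks n w) = k]) =
      (p * P (setT `&` [set w | pickle (ranks n w) = k]))%E.
    rewrite setTI setIC muleC; have [[u ->]|->] := pickle_ranks n k; last first.
      by rewrite set0I !measure0 mul0e.
    rewrite fiber_cylinder; case: eqP => _; first by rewrite cylS.
    by rewrite set0I !measure0 mul0e.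
  rewrite (total_probability P mY mZ) (eq_eseriesr (fun k _ => e k)).
  rewrite -(fineK p_fin) nneseriesZl// -(total_probability P mY measurableT).
  by rewrite probability_setT mule1.
rewrite PZ; move: FS; rewrite -PZ => FS.
apply: (indep_sigma_algebra _ mZ _ _ FS).2.
- exact: cylinders_setI.
- exact: measurable_cylinders.
- by move=> _ [B' [J' [I' [mB' ->]]]]; rewrite PZ; exact: cylS.
Qed.

Lemma sub_sigma_measurable n S : <<s cylinders n>> S -> measurable S.
Proof.
apply: smallest_sub; first exact: sigma_algebra_measurable.
exact: measurable_cylinders.
Qed.

(** First of the marginals of [indep_slot]: the request rank is summed out here, and the following
    lemmas isolate each single variable. *)
Lemma indep_ranks n S B j : <<s cylinders n>> S -> measurable B ->
  P (S `&` (A n @^-1` B `&` [set w | X n w = j])) =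
  (P S * P (A n @^-1` B `&` [set w | X n w = j]))%E.
Proof.
move=> FS mB; apply: (indep_marginal (mRq n)).
- exact: sub_sigma_measurable FS.
- by apply: measurableI => //; exact: measurable_preimage.
- by move=> i; exact: indep_slot.
Qed.

Lemma indep_energy n S B : <<s cylinders n>> S -> measurable B ->
  P (S `&` (A n @^-1` B)) = (P S * P (A n @^-1` B))%E.
Proof.
move=> FS mB; apply: (indep_marginal (mX n)).
- exact: sub_sigma_measurable FS.
- exact: measurable_preimage.
- by move=> i; exact: indep_ranks.
Qed.

Lemma indep_removal n S j : <<s cylinders n>> S ->
  P (S `&` [set w | X n w = j]) = (P S * P [set w | X n w = j])%E.
Proof.
by move=> FS; have := @indep_ranks n S setT j FS measurableT; rewrite preimage_setT setTI.
Qed.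

Lemma indep_request n S i : <<s cylinders n>> S ->
  P (S `&` [set w | Rq n w = i]) = (P S * P [set w | Rq n w = i])%E.
Proof.
move=> FS; apply: (indep_marginal (mX n)) => //.
- exact: sub_sigma_measurable FS.
- move=> j; have := @indep_slot n S setT j i FS measurableT.
  by rewrite preimage_setT setTI (setIC [set w | X n w = j]).
Qed.

End Cylinders.

(** * Measurability of the state with respect to the past *)

Section Adapted.
Context d (T : measurableType d) (R : realType).
Variables (A : nat -> T -> R) (X Rq : nat -> T -> nat).

Let F n := g_sigma_algebraType (cylinders A X Rq n).

Let cylinder_adapted n B J I : (forall k, measurable (B k)) ->
  measurable (cylinder A X Rq n B J I : set (F n)).
Proof. by move=> mB; apply: sub_sigma_algebra; exists B, J, I. Qed.

Lemma ranks_adapted n u : measurable ([set w | ranks X Rq n w = u] : set (F n)).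
Proof.
rewrite (fiber_cylinder A); case: eqP => _; last exact: measurable0.
exact: cylinder_adapted.
Qed.

Lemma removal_adapted n k j : (k < n)%N ->
  measurable ([set w | X k w = j] : set (F n)).
Proof.
move=> kn; pose Q (u : seq (nat * nat)) : set (F n) :=
  if (nth (0, 0)%N u k).1 == j then setT else set0.
have := @measurable_countable_comp _ (F n) _ (ranks X Rq n) Q (@ranks_adapted n).
rewrite (_ : [set w | Q _ w] = [set w | X k w = j]).
  by apply => u; rewrite /Q; case: eqP.
apply/seteqP; split => w; rewrite /Q /= nth_mkseq//=; first by case: eqP.
by move=> ->; rewrite eqxx.
Qed.

Lemma request_adapted n k i : (k < n)%N ->
  measurable ([set w | Rq k w = i] : set (F n)).
Proof.
move=> kn; pose Q (u : seq (nat * nat)) : set (F n) :=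
  if (nth (0, 0)%N u k).2 == i then setT else set0.
have := @measurable_countable_comp _ (F n) _ (ranks X Rq n) Q (@ranks_adapted n).
rewrite (_ : [set w | Q _ w] = [set w | Rq k w = i]).
  by apply => u; rewrite /Q; case: eqP.
apply/seteqP; split => w; rewrite /Q /= nth_mkseq//=; first by case: eqP.
by move=> ->; rewrite eqxx.
Qed.

Lemma energy_adapted n k : (k < n)%N -> measurable_fun (setT : set (F n)) (A k).
Proof.
move=> kn _ B mB; rewrite setTI.
(* Constrains the energy in slot [k] alone; splitting over rank histories then turns the event into
   a countable union of cylinders. *)
pose B' i : set R := if i == k then B else setT.
have mB' i : measurable (B' i) by rewrite /B'; case: eqP.
pose Q (u : seq (nat * nat)) : set (F n) :=
  [set w | ranks X Rq n w = u] `&` [set w | forall i, (i < n)%N -> B' i (A i w)].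
have := @measurable_countable_comp _ (F n) _ (ranks X Rq n) Q (@ranks_adapted n).
rewrite (_ : [set w | Q _ w] = A k @^-1` B).
  apply => u; rewrite /Q ranks_cylinder; case: eqP => _; last exact: measurable0.
  exact: cylinder_adapted.
apply/seteqP; split => w; rewrite /Q /=.
  by move=> [_ /(_ _ kn)]; rewrite /B' eqxx.
by move=> Bw; split => // i _; rewrite /B'; case: eqP => // ->.
Qed.

(** The state of slot [k] uses only slots strictly before [k], hence [k <= n] where the primitive
    variables need [k < n]. *)
Lemma state_adapted (Cthr C0 : nat) (Ep E0 : R) n k : (k <= n)%N ->
  (forall c, measurable
    ([set w | (potb_state Cthr Ep C0 E0 A X k w).1 = c] : set (F n))) /\
  measurable_fun (setT : set (F n)) (fun w => (potb_state Cthr Ep C0 E0 A X k w).2).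
Proof.
elim: k => [_|k IH kn].
  split => [c|/=]; last exact: measurable_cst.
  rewrite (_ : [set w | _] = if C0 == c then setT else set0); first by case: eqP.
  by apply/seteqP; split => w /=; case: eqP.
have [mC mE] := IH (ltnW kn).
pose C w := (potb_state Cthr Ep C0 E0 A X k w).1.
pose E w := (potb_state Cthr Ep C0 E0 A X k w).2.
pose push w := potb_push Cthr Ep (C w) (E w).
have mpush : measurable ([set w | push w] : set (F n)).
  pose Q c : set (F n) := if (c < Cthr)%N then [set w | Ep <= E w] else set0.
  have := @measurable_countable_comp _ (F n) _ C Q mC.
  rewrite (_ : [set w | Q _ w] = [set w | push w]); last first.
    by apply/seteqP; split => w; rewrite /Q /push /potb_push /=; case: ltnP.
  apply => c; rewrite /Q; case: ltnP => // _.
  rewrite (_ : [set w | _] = setT `&` E @^-1` `[Ep, +oo[%classic).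
    by apply: mE => //; exact: measurable_itv.
  by rewrite setTI; apply/seteqP; split => w /=; rewrite in_itv/= andbT.
have mpushb b : measurable (push @^-1` [set b] : set (F n)).
  case: b; first exact: mpush.
  rewrite (_ : _ @^-1` _ = ~` [set w | push w]); first exact: measurableC.
  by apply/seteqP; split => w /=; [move=> ->|move/negP/negbTE].
split => [c|/=]; last first.
  apply: measurable_funD; last exact: energy_adapted.
  apply: measurable_funB => //.
  apply: measurable_fun_ifT => //.
  by apply: (@measurable_fun_bool _ _ _ _ true); rewrite setTI; exact: mpush.
(* The next cached count is a function of this countably valued triple. *)
pose h w := (C w, push w, X k w).
pose Q (u : nat * bool * nat) : set (F n) :=
  if (u.1.1 + u.1.2 - ((0 < u.2)%N && (u.2 <= u.1.1)%N))%N == c then setT else set0.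
have := @measurable_countable_comp _ (F n) _ h Q.
rewrite (_ : [set w | Q _ w] = [set w | (potb_state Cthr Ep C0 E0 A X k.+1 w).1 = c]).
  apply => [u|u]; last by rewrite /Q; case: eqP.
  apply: (@measurable_pair_fiber _ (F n) _ _ (fun w => (C w, push w)) (X k)).
    exact: (@measurable_pair_fiber _ (F n) _ _ C push).
  by move=> v; exact: removal_adapted.
by apply/seteqP; split => w; rewrite /Q /=; case: eqP.
Qed.

End Adapted.

Lemma indic_fiber (T : Type) (V : eqType) (R : pzRingType) (f : T -> V) c w :
  \1_[set w | f w = c] w = (f w == c)%:R :> R.
Proof. by rewrite indicE; congr (nat_of_bool _)%:R; apply/idP/eqP; rewrite inE. Qed.

Lemma sum_nat_fiber (R : pzRingType) c x :
  \sum_(j < c) (x == j.+1)%:R = ((0 < x)%N && (x <= c)%N)%:R :> R.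
Proof.
elim: c => [|c IH]; first by rewrite big_ord0; case: x.
rewrite big_ord_recr/= IH (leq_eqVlt x c.+1) ltnS.
case: (eqVneq x c.+1) => [->|_] /=; last by rewrite addr0.
by rewrite ltnn add0r.
Qed.

(** * Long-run frequencies *)

Lemma sum_nat_eq (R : pzRingType) (n x : nat) : \sum_(i < n) (x == i)%:R = (x < n)%N%:R :> R.
Proof.
elim: n => [|n IH]; first by rewrite big_ord0.
rewrite big_ord_recr/= IH ltnS (leq_eqVlt x n).
case: (eqVneq x n) => [->|_] /=; last by rewrite addr0.
by rewrite ltnn add0r.
Qed.

(** A push serves exactly rank [c.+1], so it acts as one more cached content. *)
Lemma blocked_rank (c r : nat) (p : bool) :
  [&& (0 < r)%N, (c < r)%N & ~~ (p && (r == c.+1))] = (c + p < r)%N.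
Proof. by case: p => /=; lia. Qed.

Section LongRun.
Context d (T : measurableType d) (R : realType) (P : probability T R).
Variables (A : nat -> T -> R) (X Rq : nat -> T -> nat).
Hypotheses (mA : forall k, measurable_fun setT (A k))
  (mX : forall k j, measurable [set w | X k w = j])
  (mRq : forall k i, measurable [set w | Rq k w = i]).
Hypothesis indep : forall n (B : nat -> set R) (J I : nat -> nat),
  (forall k, measurable (B k)) ->
  P (cylinder A X Rq n B J I) = (\prod_(k < n) (P (A k @^-1` B k) *
     P [set w | X k w = J k] * P [set w | Rq k w = I k]))%E.

Let F n := g_sigma_algebraType (cylinders A X Rq n).

(** The law is applied to each pair of a cached count [c] and a removed rank [j]. There are
    countably many pairs, so one null set serves every [phi]. *)
Lemma removals_law (N Cthr C0 : nat) (Ep E0 q : R) :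
  (forall k j, (1 <= j <= N)%N -> P [set w | X k w = j] = q%:E) ->
  let C k w := (potb_state Cthr Ep C0 E0 A X k w).1 in
  (forall k w, (C k w <= N)%N) ->
  {ae P, forall w, forall phi : nat -> R, subl (fun K => \sum_(k < K)
    phi (C k w) * (((0 < X k w)%N && (X k w <= C k w)%N : nat)%:R - q * (C k w)%:R))}.
Proof.
move=> PX C CleN.
have mS k c : measurable ([set w | C k w = c] : set (F k)).
  exact: (state_adapted _ _ _ _ _ _ _ (leqnn k)).1.
have mSl k l c : (k <= l)%N -> measurable ([set w | C k w = c] : set (F l)).
  by move=> kl; exact: (state_adapted _ _ _ _ _ _ _ kl).1.
have ae1 c j : (1 <= j <= N)%N -> {ae P, forall w,
    subl (fun K => \sum_(k < K)
      \1_[set w | C k w = c] w * (\1_[set w | X k w = j] w - q)) /\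
    subl (fun K => \sum_(k < K)
      \1_[set w | C k w = c] w * (q - \1_[set w | X k w = j] w))}.
  move=> jN.
  apply: (@slln_predictable _ _ _ P (fun k => [set w | C k w = c])
    (fun k => [set w | X k w = j])) => // [k|k|i l il|i l il].
  - exact: (sub_sigma_measurable mA mX mRq (mS k c)).
  - exact: PX.
  - rewrite -(PX l j jN); apply: (indep_removal mA mX mRq indep).
    apply: (@measurableI _ (F l)); last exact: mS.
    apply: (@measurableI _ (F l)); first exact: mSl (ltnW il).
    exact: removal_adapted.
  - rewrite -(PX l j jN); apply: (indep_removal mA mX mRq indep).
    by apply: (@measurableI _ (F l)); [exact: mSl (ltnW il)|exact: mS].
have ae2 : {ae P, forall w, forall c j, (1 <= j <= N)%N ->
    subl (fun K => \sum_(k < K)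
      \1_[set w | C k w = c] w * (\1_[set w | X k w = j] w - q)) /\
    subl (fun K => \sum_(k < K)
      \1_[set w | C k w = c] w * (q - \1_[set w | X k w = j] w))}.
  apply: ae_foralln => c; apply: ae_foralln => j.
  have [jN|jN] := boolP (1 <= j <= N)%N; last exact: aeW.
  by move: (ae1 c j jN); apply: filterS => w ? _.
move: ae2; apply: filterS => w hw phi.
(* In each slot only [c = C k w] survives, and the ranks [j.+1 <= c] add up to the removal indicator
   minus [q * c]. *)
have sx : subl (fun K => \sum_(c < N.+1) \sum_(j < N | (j < c)%N)
    phi c * \sum_(k < K)
      \1_[set w | C k w = c] w * (\1_[set w | X k w = j.+1] w - q)).
  apply: subl_sum => c _; apply: subl_sum => j _.
  have [h1 h2] := hw c j.+1 (ltn_ord j : (1 <= j.+1 <= N)%N).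
  apply: subl_scale => //; apply: (@subl_le _ _ _ 0 _ h2) => K.
  by rewrite addr0 -sumrN ler_sum// => k _; rewrite -mulrN opprB.
apply: (@subl_le _ _ _ 0 _ sx) => K; rewrite addr0 le_eqVlt; apply/orP; left; apply/eqP.
under [RHS]eq_bigr do under eq_bigr do rewrite mulr_sumr.
under [RHS]eq_bigr do rewrite exchange_big/=.
rewrite [RHS]exchange_big/=; apply: eq_bigr => k _.
have Ck : (C k w < N.+1)%N by rewrite ltnS CleN.
rewrite [RHS](bigD1 (Ordinal Ck))//= [X in _ = _ + X]big1 ?addr0; last first.
  move=> c cC; rewrite big1// => j _; rewrite indic_fiber.
  rewrite (_ : _ == _ = false) ?mul0r ?mulr0//.
  by apply: contra_neqF cC => /eqP Cc; exact: val_inj.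
rewrite -mulr_sumr; congr (_ * _).
rewrite (big_ord_narrow (CleN k w))/=.
under eq_bigr do rewrite !indic_fiber eqxx mul1r.
by rewrite sumrB sum_nat_fiber sumr_const card_ord mulr_natr.
Qed.

Lemma requests_law (r : R) i : (forall k, P [set w | Rq k w = i] = r%:E) ->
  {ae P, forall w, subl (fun K => \sum_(k < K) ((Rq k w == i)%:R - r)) /\
    subl (fun K => \sum_(k < K) (r - (Rq k w == i)%:R))}.
Proof.
move=> PR.
have mRF k l : (k < l)%N -> <<s cylinders A X Rq l>> [set w | Rq k w = i].
  exact: request_adapted.
have := @slln_predictable _ _ _ P (fun=> setT) (fun k => [set w | Rq k w = i]) r.
have h k l : (k < l)%N ->
    P ([set w | Rq k w = i] `&` [set w | Rq l w = i]) = (P [set w | Rq k w = i] * r%:E)%E.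
  by move=> kl; rewrite (indep_request mA mX mRq indep i (mRF _ _ kl)) (PR l).
move=> /(_ (fun=> measurableT) (fun k => mRq k i) PR).
move=> H; have {H} := H _ _.
have h1 k l : (k < l)%N -> P (setT `&` [set w | Rq k w = i] `&` setT `&`
    [set w | Rq l w = i]) = (P (setT `&` [set w | Rq k w = i] `&` setT) * r%:E)%E.
  by move=> kl; rewrite setTI setIT (h _ _ kl).
have h2 k l : (k < l)%N -> P (setT `&` setT `&` [set w | Rq l w = i]) =
    (P (setT `&` setT : set T) * r%:E)%E.
  by move=> kl; rewrite !setTI PR probability_setT mul1e.
move=> /(_ h1 h2); apply: filterS => w [s1 s2]; split.
  apply: (@subl_le _ _ _ 0 _ s1) => K; rewrite addr0 ler_sum// => k _.
  by rewrite indicT mul1r indic_fiber.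
apply: (@subl_le _ _ _ 0 _ s2) => K; rewrite addr0 ler_sum// => k _.
by rewrite indicT mul1r indic_fiber.
Qed.

Import HBNNSimple.

(** The integral is a supremum over simple functions below. It is taken for the law of [A 0] on the
    real line, so that the same [h] applies to every slot. *)
Lemma simple_minorant (Abar e : R) : (forall k w, 0 <= A k w) ->
  (\int[P]_w (A 0%N w)%:E = Abar%:E)%E -> 0 < e ->
  exists h : {nnsfun R >-> R}, (forall x, 0 <= x -> h x <= x) /\
    Abar - e <= \sum_(v <- finmap.enum_fset (fset_set (range h)))
      v * fine (P (A 0%N @^-1` (h @^-1` [set v]))).
Proof.
move=> A0 EA e0.
pose mu := pushforward P (A 0%N).
(* The absolute value is a nonnegative function on the whole line that agrees with the identity on
   harvests. *)
have : ((Abar - e)%:E < \int[mu]_x (`|x|)%:E)%E.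
  rewrite ge0_integral_pushforward//; last first.
    by apply/measurable_EFinP.
  rewrite preimage_setT.
  under eq_integral do rewrite /= ger0_norm//.
  by rewrite EA lte_fin ltrBlDr ltrDl.
rewrite ge0_integralTE => [|x]; last by rewrite lee_fin.
move=> /ereal_sup_gt[_ [/= h hle <-] lth].
exists h; split => [x x0|].
  by have := hle x; rewrite lee_fin ger0_norm.
rewrite -lee_fin (le_trans (ltW lth))// sintegralE fsbig_finite//=.
rewrite -sumEFin; apply: lee_sum => v _.
rewrite EFinM fineK; first exact: lexx.
by apply: fin_num_measure; apply: (measurable_preimage mA); exact: measurable_sfunP.
Qed.

(** Harvests may be unbounded, but the events that [h (A k w)] equals [v] obey the bounded strong
    law; weighting them by [v] bounds the harvest from below. *)
Lemma harvest_law (Abar : R) : (forall k w, 0 <= A k w) ->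
  (\int[P]_w (A 0%N w)%:E = Abar%:E)%E ->
  (forall k B, measurable B -> P (A k @^-1` B) = P (A 0%N @^-1` B)) ->
  {ae P, forall w, subl (fun K => Abar * K%:R - \sum_(k < K) A k w)}.
Proof.
move=> A0 EA id_A.
have aev (h : {nnsfun R >-> R}) v : {ae P, forall w, subl (fun K =>
    \sum_(k < K) (fine (P (A 0%N @^-1` (h @^-1` [set v]))) - (h (A k w) == v)%:R))}.
  have mv : measurable (h @^-1` [set v]) by exact: measurable_sfunP.
  have mZ k := measurable_preimage mA k mv.
  set r := fine _.
  have PZ k : P (A k @^-1` (h @^-1` [set v])) = r%:E.
    by rewrite id_A// fineK// fin_num_measure.
  have h1 k l : (k < l)%N -> P (setT `&` A k @^-1` (h @^-1` [set v]) `&` setT `&`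
      A l @^-1` (h @^-1` [set v])) =
      (P (setT `&` A k @^-1` (h @^-1` [set v]) `&` setT) * r%:E)%E.
    move=> kl; rewrite setTI setIT -(PZ l); apply: (indep_energy mA mX mRq indep) => //.
    rewrite -[A k @^-1` _]setTI.
    exact: (@energy_adapted _ T R A X Rq l k kl measurableT _ mv).
  have h2 k l : (k < l)%N -> P (setT `&` setT `&` A l @^-1` (h @^-1` [set v])) =
      (P (setT `&` setT : set T) * r%:E)%E.
    by move=> kl; rewrite !setTI PZ probability_setT mul1e.
  move: (@slln_predictable _ _ _ P (fun=> setT) _ r (fun=> measurableT) mZ PZ h1 h2).
  apply: filterS => w [_ s2]; apply: (@subl_le _ _ _ 0 _ s2) => K.
  rewrite addr0 ler_sum// => k _.
  by rewrite indicT mul1r (@indic_fiber _ _ _ (fun w => h (A k w))).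
have aeh (h : {nnsfun R >-> R}) (vs : seq R) : {ae P, forall w, forall v, v \in vs ->
    subl (fun K => \sum_(k < K)
      (fine (P (A 0%N @^-1` (h @^-1` [set v]))) - (h (A k w) == v)%:R))}.
  move: (ae_foralln (fun n => aev h (nth 0 vs n))); apply: filterS => w hw v vvs.
  by rewrite -(nth_index 0 vvs); exact: hw.
(* Countably many tolerances [n.+1%:R^-1] keep the exceptional set null. *)
have ae1 n : {ae P, forall w,
    subl (fun K => (Abar - n.+1%:R^-1) * K%:R - \sum_(k < K) A k w)}.
  have n0 : 0 < n.+1%:R^-1 :> R by [].
  have [h [hle hE]] := simple_minorant A0 EA n0.
  move: hE; set vs := finmap.enum_fset _ => hE.
  move: (aeh h vs); apply: filterS => w hw.
  pose r v := fine (P (A 0%N @^-1` (h @^-1` [set v]))).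
  have s : subl (fun K => \sum_(v <- vs | (v \in vs) && (0 <= v)) v *
      \sum_(k < K) (r v - (h (A k w) == v)%:R)).
    by apply: subl_sum => v /andP[vvs v0]; apply: sublZ => //; exact: hw.
  have vs0 v : v \in vs -> 0 <= v.
    by rewrite in_fset_set// inE => -[x _ <-].
  apply: (@subl_le _ _ _ 0 _ s) => K; rewrite addr0.
  under [leRHS]eq_bigr do rewrite mulr_sumr.
  rewrite exchange_big/=.
  have -> : (Abar - n.+1%:R^-1) * K%:R - \sum_(k < K) A k w =
      \sum_(k < K) (Abar - n.+1%:R^-1 - A k w).
    by rewrite sumrB sumr_const card_ord mulr_natr.
  apply: ler_sum => k _.
  have -> : \sum_(v <- vs | (v \in vs) && (0 <= v)) v * (r v - (h (A k w) == v)%:R) =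
      \sum_(v <- vs) v * r v - \sum_(v <- vs) v * (h (A k w) == v)%:R.
    rewrite -sumrB big_mkcond/= [RHS]big_seq [LHS]big_seq; apply: eq_bigr => v vvs.
    by rewrite vvs (vs0 _ vvs) mulrBr.
  apply: lerB => //.
  (* Only [v = h (A k w)] contributes to the weighted sum, which therefore equals [h (A k w)], at
     most [A k w]. *)
  have hv : h (A k w) \in vs by rewrite in_fset_set// inE; exists (A k w).
  rewrite (bigD1_seq (h (A k w)))//= ?eqxx ?mulr1; last exact: finmap.fset_uniq.
  rewrite big1 ?addr0; first exact: hle.
  by move=> v vh; rewrite eq_sym (negbTE vh) mulr0.
move: (ae_foralln ae1); apply: filterS => w hw e e0.
have e2 : 0 < e / 2 :> R by lra.
have [n ne] : exists n, n.+1%:R^-1 < e / 2.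
  exists (Num.bound `|(e / 2)^-1|).
  rewrite invf_plt ?posrE//.
  rewrite (le_lt_trans (ler_norm _))// (lt_le_trans (archi_boundP _))//.
  by rewrite ler_nat.
have [B HB] := hw n _ e2; exists B => K.
have h1 := HB K.
have h2 : n.+1%:R^-1 * K%:R <= e / 2 * K%:R by rewrite ler_wpM2r// ltW.
move: h1 h2; rewrite /= mulrBl.
by move: (n.+1%:R^-1) (\sum_(k < K) A k w) => t s; lra.
Qed.

End LongRun.

(** * The blocking frequency of the policy *)

Theorem theorem1 (R : realType) (d : measure_display) (T : measurableType d)
  (P : probability T R) (N : nat) (v pc pu Ep Abar : R) (C0 : nat) (E0 : R)
  (A : nat -> T -> R) (X Rq : nat -> T -> nat) :
  (0 < N)%N -> 0 <= v -> 0 < pc -> pc <= 1 -> 0 <= pu -> pu <= 1 ->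
  0 < Ep -> 0 < Abar -> (C0 <= N)%N -> 0 <= E0 ->
  (* measurability of the primitive random variables *)
  (forall k, measurable_fun setT (A k)) ->
  (forall k j, measurable [set w | X k w = j]) ->
  (forall k i, measurable [set w | Rq k w = i]) ->
  (* harvested energies: nonnegative, identically distributed, mean Abar *)
  (forall k w, 0 <= A k w) ->
  (forall k (B : set R), measurable B ->
     P (A k @^-1` B) = P (A 0%N @^-1` B)) ->
  (\int[P]_w (A 0%N w)%:E = Abar%:E)%E ->
  (* popularity dynamics: w.p. p_c a uniformly chosen content is removed *)
  (forall k j, P [set w | X k w = j] =
     (if (1 <= j <= N)%N then pc / N%:R else if j == 0%N then 1 - pc else 0)%:E) ->
  (* requests: w.p. p_u a request, for c_i w.p. f_i *)
  (forall k i, P [set w | Rq k w = i] =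
     (if (1 <= i <= N)%N then pu * popularity N v i
      else if i == 0%N then 1 - pu else 0)%:E) ->
  (* mutual independence of all A k, X k, Rq k *)
  (forall (n : nat) (B : nat -> set R) (J I : nat -> nat),
     (forall k, measurable (B k)) ->
     P (\big[setI/setT]_(k < n)
          (A k @^-1` B k `&` [set w | X k w = J k] `&` [set w | Rq k w = I k]))
     = (\prod_(k < n) (P (A k @^-1` B k) * P [set w | X k w = J k]
                        * P [set w | Rq k w = I k]))%E) ->
  {ae P, forall w,
     (fun K : nat => K%:R^-1 *
        \sum_(k < K) ((potb_blocked (Cthr_PO N pc Ep Abar) Ep C0 E0 A X Rq k w : nat)%:R : R))
     @ \oo --> (pu * (1 - \sum_(1 <= i < (Cthr_PO N pc Ep Abar).+1) popularity N v i) : R^o)}.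
Proof.
move=> N0 _ pc0 pc1 _ _ Ep0 Abar0 C0N _ mA mX mRq A0 id_A EA PX PR indep.
pose m := Cthr_PO N pc Ep Abar.
pose q : R := pc / N%:R.
have NR : 0 < N%:R :> R by rewrite ltr0n.
have q0 : 0 < q by rewrite divr_gt0.
have qN : q * N%:R <= 1 by rewrite divfK ?gt_eqF.
have mN : (m <= N)%N by exact: geq_minl.
(* The floor in the threshold with denominators cleared: the energy rate needed to hold [m] contents
   is sustainable. *)
have mle : m%:R * q * Ep <= (1 + q) * Abar.
  pose x := (N%:R + pc) * Abar / (pc * Ep).
  have x0 : 0 <= x.
    by rewrite divr_ge0 ?mulr_ge0 ?addr_ge0// ltW.
  have : m%:R <= x.
    by rewrite -truncn_ge_nat//; exact: geq_minr.
  rewrite ler_pdivlMr ?mulr_gt0// => h.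
  rewrite -(ler_pM2l NR).
  have -> : N%:R * (m%:R * q * Ep) = m%:R * (pc * Ep) by rewrite /q; field; rewrite gt_eqF.
  by have -> : N%:R * ((1 + q) * Abar) = (N%:R + pc) * Abar by rewrite /q; field; rewrite gt_eqF.
pose St k w := potb_state m Ep C0 E0 A X k w.
pose C k w := (St k w).1; pose E k w := (St k w).2.
pose push k w := potb_push m Ep (C k w) (E k w).
pose D k w : nat := (0 < X k w)%N && (X k w <= C k w)%N.
have tr w : trajectory m Ep (C ^~ w) (D ^~ w) (push ^~ w) (E ^~ w) (A ^~ w).
  split=> // k; rewrite /D; last by case: (_ && _).
  case: (posnP (X k w)) => //= X0; case: (leqP (X k w) (C k w)) => //= XC.
  exact: leq_trans X0 XC.
have CN k w : (C k w <= N)%N by exact: (cached_le_stable (tr w) mN (leq0n k) C0N).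
pose r i : R := if (1 <= i)%N then pu * popularity N v i else 1 - pu.
have PRi k i : (i <= N)%N -> P [set w | Rq k w = i] = (r i)%:E.
  by move=> iN; rewrite PR iN andbT /r; case: i {iN}.
pose L := pu * (1 - \sum_(1 <= i < m.+1) popularity N v i).
(* The limit is the probability of a request of rank above [m]; index 0 stands for no request. *)
have LE : L = 1 - \sum_(i < m.+1) r i.
  rewrite big_ord_recl/= /L big_add1/= big_mkord /r/= mulrBr mulr1 mulr_sumr.
  by rewrite opprD opprB addrA addrCA subrr addr0.
have PXj k j : (1 <= j <= N)%N -> P [set w | X k w = j] = q%:E.
  by move=> jN; rewrite PX jN.
have ae_rem := removals_law mA mX mRq indep PXj CN.
have ae_har := harvest_law mA mX mRq indep A0 EA id_A.
have ae_req : {ae P, forall w, forall i, (i <= m)%N ->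
    subl (fun K => \sum_(k < K) ((Rq k w == i)%:R - r i)) /\
    subl (fun K => \sum_(k < K) (r i - (Rq k w == i)%:R))}.
  apply: ae_foralln => i; have [im|im] := leqP i m; last exact: aeW.
  have := requests_law mA mX mRq indep (fun k => PRi k i (leq_trans im mN)).
  by apply: filterS => w + _.
move: ae_rem ae_har ae_req; apply: filterS3 => w hrem hhar hreq.
have hG := cached_eq_threshold (tr w) mN C0N q0 qN Ep0 mle hhar hrem.
pose b k : R := (potb_blocked m Ep C0 E0 A X Rq k w)%:R.
pose g k : R := (C k w + push k w != m)%N%:R.
(* The blocking indicator if the level [C k w + push k w] were always [m], written as a complement
   so that finitely many request frequencies determine its mean. *)
pose t k : R := 1 - \sum_(i < m.+1) (Rq k w == i)%:R.
have bE k : b k = (C k w + push k w < Rq k w)%N%:R.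
  by congr (nat_of_bool _)%:R; exact: blocked_rank.
have tE k : t k = (m < Rq k w)%N%:R.
  by rewrite /t sum_nat_eq ltnS; case: leqP => _; rewrite ?subrr ?subr0.
have btg k : `|b k - t k| <= g k.
  rewrite bE tE /g; case: eqVneq => [->|_] /=; first by rewrite subrr normr0.
  by case: ltnP => _; case: ltnP => _ /=; rewrite ?subrr ?subr0 ?sub0r ?normrN ?normr0 ?normr1.
have sub_g : subl (fun K => \sum_(k < K) g k) by exact: hG.
have tLE K : \sum_(k < K) (t k - L) =
    \sum_(i < m.+1) \sum_(k < K) (r i - (Rq k w == i)%:R).
  rewrite exchange_big/=; apply: eq_bigr => k _.
  by rewrite /t LE sumrB; ring.
have sub_b : subl (fun K => \sum_(k < K) (b k - L)).
  apply: (@subl_le _ _ (fun K => \sum_(k < K) g k + \sum_(k < K) (t k - L)) 0).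
    move=> K; rewrite addr0 -big_split/=; apply: ler_sum => k _.
    by have := btg k; rewrite ler_norml => /andP[_]; lra.
  have s2 : subl (fun K => \sum_(i < m.+1) \sum_(k < K) (r i - (Rq k w == i)%:R)).
    by apply: subl_sum => i _; exact: (hreq _ (ltn_ord i)).2.
  by apply: sublD => //; apply: (@subl_le _ _ _ 0 _ s2) => K; rewrite addr0 tLE.
have sub_Nb : subl (fun K => - \sum_(k < K) (b k - L)).
  apply: (@subl_le _ _ (fun K => \sum_(k < K) g k - \sum_(k < K) (t k - L)) 0).
    move=> K; rewrite addr0 -sumrN -sumrB; apply: ler_sum => k _.
    by have := btg k; rewrite ler_norml => /andP[]; lra.
  have s1 : subl (fun K => \sum_(i < m.+1) \sum_(k < K) ((Rq k w == i)%:R - r i)).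
    by apply: subl_sum => i _; exact: (hreq _ (ltn_ord i)).1.
  apply: sublD => //; apply: (@subl_le _ _ _ 0 _ s1) => K.
  rewrite addr0 tLE -sumrN; apply: ler_sum => i _; rewrite -sumrN; apply: ler_sum => k _.
  by rewrite opprB.
exact: subl_mean_cvg sub_b sub_Nb.
Qed.
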